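(* Let $A\in\mathbb{R}^{n\times n}$ be diagonalizable (over $\mathbb{C}$) with eigenvalues $\lambda_1,\dots,\lambda_n$ counted with multiplicity. Let $\lambda_1$ be simple, real and negative, and let $\lambda_1>\Re(\lambda_j)$ for all $j\ge 2$. Let $w^1,\dots,w^n$ be linearly independent left eigenvectors of $A$ corresponding to $\lambda_1,\dots,\lambda_n$, with $w^1$ real. For positive scalars $\alpha_2,\dots,\alpha_n$ define $$\mathcal{K}_\alpha=\left\{y\in\mathbb{R}^n \;\middle|\; \left(\sum_{i=2}^n\alpha_i\,|(w^i)^Ty|^2\right)^{1/2}\le (w^1)^Ty\right\}.$$ Then for any positive scalars $\alpha_i$, $i=2,\dots,n$, the system $\dot x=Ax$ is $\mathcal{K}_\alpha$-positive.
   Context: A left eigenvector $w^i\in\mathbb{C}^n$ of $A$ corresponding to $\lambda_i$ is a nonzero vector with $(w^i)^TA=\lambda_i(w^i)^T$ (transpose, no conjugation). The system $\dot x=Ax$ is $\mathcal{K}$-positive if $e^{At}\mathcal{K}\subseteq\mathcal{K}$ for all $t\ge 0$. *)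

(* Defs.v *)
From HB Require Import structures.
From mathcomp Require Import all_boot all_order all_algebra.
From mathcomp Require Import all_classical all_reals all_analysis.
From mathcomp Require Import complex.

Set Implicit Arguments.
Unset Strict Implicit.
Unset Printing Implicit Defensive.

Import Order.TTheory GRing.Theory Num.Theory.
Import numFieldNormedType.Exports.

Local Open Scope classical_set_scope.
Local Open Scope ring_scope.
Local Open Scope complex_scope.

Definition complexmx (R : realType) (m n : nat) (A : 'M[R]_(m, n)) :
    'M[R[i]]_(m, n) :=
  map_mx (real_complex R) A.

Definition left_eigenvector (R : realType) (n : nat) (A : 'M[R]_n)
    (lambda : R[i]) (w : 'cV[R[i]]_n) : Prop :=
  w != 0 /\ w^T *m complexmx A = lambda *: w^T.

(* The series converges for every A, in the max-norm topology of matrices. *)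
Definition expmx (R : realType) (n : nat) (A : 'M[R]_n.+1) : 'M[R]_n.+1 :=
  lim (series (fun k => k`!%:R^-1 *: A ^+ k) @ \oo).

Definition positive_system (R : realType) (n : nat) (A : 'M[R]_n.+1)
    (K : set 'cV[R]_n.+1) : Prop :=
  forall t : R, 0 <= t -> [set expmx (t *: A) *m x | x in K] `<=` K.

(* w^T y is bilinear: w is transposed, not conjugated. *)
Definition pairing (R : realType) (n : nat) (w : 'cV[R[i]]_n)
    (y : 'cV[R]_n) : R[i] :=
  (w^T *m complexmx y) ord0 ord0.

(* Indices start at 0: [ord0] is the distinguished first index, and the value
   [alpha ord0] is not used.  The inequality is in the partial order of R[i],
   where a <= b means that b - a is real and nonnegative; its right-hand side
   is real for every y when w ord0 has real entries. *)
Definition cone (R : realType) (n : nat) (w : 'I_n.+1 -> 'cV[R[i]]_n.+1)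
    (alpha : 'I_n.+1 -> R) : set 'cV[R]_n.+1 :=
  [set y | sqrtC (\sum_(i < n.+1 | i != ord0)
                    (alpha i)%:C * `|pairing (w i) y| ^+ 2)
           <= pairing (w ord0) y].

(* Main.v *)
Require Import Defs.
From HB Require Import structures.
From mathcomp Require Import all_boot all_order all_algebra.
From mathcomp Require Import all_classical all_reals all_analysis.
From mathcomp Require Import complex.
From mathcomp Require Import ring.

Set Implicit Arguments.
Unset Strict Implicit.
Unset Printing Implicit Defensive.

Import Order.TTheory GRing.Theory Num.Theory.
Import numFieldNormedType.Exports.

Local Open Scope classical_set_scope.
Local Open Scope ring_scope.
Local Open Scope complex_scope.

(** The cone is invariant because the flow acts on each coordinate (w^i)^T y by
    a scalar: if w^T A = lambda w^T, then w^T e^{tA} y = e^{lambda t} w^T y.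
    Hence the right-hand side of the inequality that defines the cone is
    multiplied by e^{lambda_1 t}, while each |(w^i)^T y| on the left-hand side
    is multiplied by e^{Re(lambda_i) t} <= e^{lambda_1 t}, so the inequality
    persists.

    Only the modulus of e^{lambda t} matters, so no complex exponential is
    introduced.  For real r and y, the function t |-> r e^{tA} y is a power
    series in t with derivative r A e^{tA} y
    ([is_derive_mxbilinear_expmx]).  Writing w = u + iv and lambda = a + ib,
    the eigenvector equation reads u^T A = a u^T - b v^T and
    v^T A = b u^T + a v^T, so that f(t) = u^T e^{tA} y and
    g(t) = v^T e^{tA} y solve f' = a f - b g, g' = b f + a g.  Then
    (f^2 + g^2)' = 2 a (f^2 + g^2), which integrates to
    |w^T e^{tA} y|^2 = e^{2at} |w^T y|^2 ([sqr_norm_pairing_expmx]).  For w^1,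
    where the sign matters as well as the modulus, v and b vanish and f' = a f
    gives the value itself ([real_pairing_expmx]). *)

(** * Convergence of the matrix exponential *)

(** Matrices are complete and normed, but [normed_cvg] asks for the join of
    both structures. *)
HB.instance Definition _ (R : realType) (m n : nat) :=
  Complete.on 'M[R]_(m, n).

Lemma mx_norm_entry (R : realType) m n (A : 'M[R]_(m.+1, n.+1)) i j :
  `|A i j| <= `|A|.
Proof.
rewrite [leRHS]/Num.norm /= mx_normrE.
exact: (le_bigmax _ (fun ij : 'I_m.+1 * 'I_n.+1 => `|A ij.1 ij.2|) (i, j)).
Qed.

(** The max norm is submultiplicative only up to the inner dimension: an entry
    of the product is a sum of that many terms. *)
Lemma mx_norm_mulmx (R : realType) m n p (A : 'M[R]_(m.+1, n.+1))
    (B : 'M[R]_(n.+1, p.+1)) :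
  `|A *m B| <= n.+1%:R * `|A| * `|B|.
Proof.
rewrite [leLHS]/Num.norm /= mx_normrE; apply/bigmax_leP; split=> [|[i j] _ /=].
  by rewrite !mulr_ge0.
rewrite mxE (le_trans (ler_norm_sum _ _ _))//.
have -> : n.+1%:R * `|A| * `|B| = \sum_(k < n.+1) `|A| * `|B|.
  by rewrite sumr_const card_ord -mulrA mulr_natl.
by apply: ler_sum => k _; rewrite normrM ler_pM// mx_norm_entry.
Qed.

Lemma mx_norm_expr (R : realType) n (A : 'M[R]_n.+1) k :
  `|A ^+ k| <= `|1 : 'M[R]_n.+1| * (n.+1%:R * `|A|) ^+ k.
Proof.
elim: k => [|k IH]; first by rewrite !expr0 mulr1.
rewrite exprS (le_trans (mx_norm_mulmx _ _))// exprS mulrCA.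
by rewrite ler_wpM2l// mulr_ge0.
Qed.

(** Dominated by the scalar exponential series at n.+1 * `|A|. *)
Lemma is_cvg_expmx (R : realType) n (A : 'M[R]_n.+1) :
  cvgn (series (fun k => k`!%:R^-1 *: A ^+ k)).
Proof.
apply: normed_cvg.
set c := `|1 : 'M[R]_n.+1|; set M := n.+1%:R * `|A|.
apply: (@series_le_cvg _ _ (fun k => c * exp_coeff M k)) => [k|k|k|].
- exact: normr_ge0.
- apply: mulr_ge0; first exact: normr_ge0.
  by apply: exp_coeff_ge0; apply: mulr_ge0.
- rewrite /= normrZ ger0_norm ?invr_ge0// /exp_coeff/= mulrA mulrC.
  by rewrite ler_wpM2r ?invr_ge0 ?mx_norm_expr// /c mulrC.
- have -> : series (fun k => c * exp_coeff M k) =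
      (fun k => c * series (exp_coeff M) k).
    by apply/funext => k; rewrite /series/= mulr_sumr.
  by apply: is_cvgMl_tmp; exact: is_cvg_series_exp_coeff.
Qed.

(** * Differentiating the flow along a row and a column *)

Lemma continuous_mxbilinear (R : realType) m n (r : 'rV[R]_m.+1)
    (y : 'cV[R]_n.+1) :
  continuous (fun M : 'M[R]_(m.+1, n.+1) => (r *m M *m y) 0 0).
Proof.
have -> : (fun M : 'M[R]_(m.+1, n.+1) => (r *m M *m y) 0 0) =
    (fun M => \sum_j \sum_i r 0 i * M i j * y j 0).
  apply/funext => M; rewrite mxE; apply: eq_bigr => j _.
  by rewrite mxE mulr_suml.
apply: continuous_big => [|j _]; first exact: add_continuous.
apply: continuous_big => [|i _]; first exact: add_continuous.
move=> M; apply: (@cvgM _ _ (nbhs M)); last exact: cvg_cst.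
by apply: (@cvgM _ _ (nbhs M)); [exact: cvg_cst|exact: coord_continuous].
Qed.

(** Presents r e^{tA} y as a power series in the scalar t, to which termwise
    differentiation applies. *)
Lemma cvg_mxbilinear_expmx (R : realType) n (A : 'M[R]_n.+1)
    (r : 'rV[R]_n.+1) (y : 'cV[R]_n.+1) (t : R) :
  pseries (fun k => k`!%:R^-1 * (r *m A ^+ k *m y) 0 0) t @ \oo -->
  (r *m expmx (t *: A) *m y) 0 0.
Proof.
have -> : pseries (fun k => k`!%:R^-1 * (r *m A ^+ k *m y) 0 0) t =
    (fun M => (r *m M *m y) 0 0) \o
    series (fun k => k`!%:R^-1 *: (t *: A) ^+ k).
  apply/funext => m; rewrite /pseries /series /= mulmx_sumr mulmx_suml summxE.
  apply: eq_bigr => k _.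
  by rewrite exprZn scalerA -scalemxAr -scalemxAl [RHS]mxE mulrAC.
apply: continuous_cvg; first exact: continuous_mxbilinear.
exact: is_cvg_expmx.
Qed.

(** The coefficients r A^k y / k! turn into those of the row r A under formal
    differentiation, and all these series have infinite radius of convergence.
    *)
Lemma is_derive_mxbilinear_expmx (R : realType) n (A : 'M[R]_n.+1)
    (r : 'rV[R]_n.+1) (y : 'cV[R]_n.+1) (t : R) :
  is_derive t (1 : R) (fun s => (r *m expmx (s *: A) *m y) 0 0)
    ((r *m A *m expmx (t *: A) *m y) 0 0).
Proof.
pose c (r : 'rV[R]_n.+1) k := k`!%:R^-1 * (r *m A ^+ k *m y) 0 0 : R.
have limE r' s : (r' *m expmx (s *: A) *m y) 0 0 = limn (pseries (c r') s).
  by apply/esym/cvg_lim => //; exact: cvg_mxbilinear_expmx.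
have cvgc r' s : cvgn (pseries (c r') s).
  by apply/cvg_ex; eexists; exact: cvg_mxbilinear_expmx.
have diffsE r' : pseries_diffs (c r') = c (r' *m A).
  apply/funext => k; rewrite /pseries_diffs /c exprS mulmxA mulrA.
  by rewrite factS natrM invfM mulVKf.
have -> : (fun s => (r *m expmx (s *: A) *m y) 0 0) =
    (fun s => limn (pseries (c r) s)).
  by apply/funext => s; exact: limE.
rewrite limE -diffsE.
(* `|t| + 1 is a point of convergence beyond t. *)
by apply: (@pseries_snd_diffs _ _ (`|t| + 1));
  rewrite ?diffsE// [ltRHS]ger0_norm// ltrDl.
Qed.

Lemma expmx0 (R : realType) n : expmx (0 : 'M[R]_n.+1) = 1.
Proof.
apply: lim_near_cst => //; near=> k.
have /prednK <- : (0 < k)%N by near: k; exists 1%N.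
rewrite /series/= big_nat_recl//= expr0 fact0 invr1 scale1r.
by rewrite big1 ?addr0// => i _; rewrite exprS mul0r scaler0.
Unshelve. all: by end_near. Qed.

(** * Scalar linear differential equations *)

(** Multiplying by the integrating factor e^{-at} gives a constant. *)
Lemma linear_ode (R : realType) (a : R) (f : R -> R) :
  (forall t, is_derive t (1 : R) f (a * f t)) ->
  forall t, f t = expR (a * t) * f 0.
Proof.
move=> df t.
have dh s : is_derive s (1 : R) (fun s => f s * expR (- a * s)) 0.
  apply: trigger_derive.
  rewrite /GRing.scale/=; ring.
have := is_derive_0_is_cst t 0 dh.
rewrite mulr0 expR0 mulr1 => <-.
by rewrite mulrCA -expRD mulNr subrr expR0 mulr1.
Qed.

(** The rotational part b cancels in the derivative of f^2 + g^2.  This is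
    |e^{(a + ib)t}| = e^{at} in real terms. *)
Lemma planar_ode_norm (R : realType) (a b : R) (f g : R -> R) :
  (forall t, is_derive t (1 : R) f (a * f t - b * g t)) ->
  (forall t, is_derive t (1 : R) g (b * f t + a * g t)) ->
  forall t, f t ^+ 2 + g t ^+ 2 = expR (2 * a * t) * (f 0 ^+ 2 + g 0 ^+ 2).
Proof.
move=> df dg; apply: linear_ode => t.
have -> : (fun s => f s ^+ 2 + g s ^+ 2) = f * f + g * g.
  by apply/funext => s; rewrite !expr2.
apply: trigger_derive.
rewrite /GRing.scale/=; ring.
Qed.

(** * The flow seen through a left eigenvector *)

Lemma map_Re_mulmx (R : realType) m n p (w : 'M[R[i]]_(m, n))
    (B : 'M[R]_(n, p)) :
  map_mx (@complex.Re R) (w *m complexmx B) =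
  map_mx (@complex.Re R) w *m B.
Proof.
apply/matrixP => i j; rewrite !mxE (big_morph _ (id1 := 0) (op1 := +%R))//=.
- apply: eq_bigr => k _; rewrite !mxE.
  by case: (w i k) => a b /=; rewrite mulr0 subr0.
- by case=> a b [].
Qed.

Lemma map_Im_mulmx (R : realType) m n p (w : 'M[R[i]]_(m, n))
    (B : 'M[R]_(n, p)) :
  map_mx (@complex.Im R) (w *m complexmx B) =
  map_mx (@complex.Im R) w *m B.
Proof.
apply/matrixP => i j; rewrite !mxE (big_morph _ (id1 := 0) (op1 := +%R))//=.
- apply: eq_bigr => k _; rewrite !mxE.
  by case: (w i k) => a b /=; rewrite mulr0 add0r.
- by case=> a b [].
Qed.

Lemma Re_pairing (R : realType) n (w : 'cV[R[i]]_n) (y : 'cV[R]_n) :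
  complex.Re (pairing w y) = (map_mx (@complex.Re R) w^T *m y) 0 0.
Proof. by rewrite -map_Re_mulmx [RHS]mxE. Qed.

Lemma Im_pairing (R : realType) n (w : 'cV[R[i]]_n) (y : 'cV[R]_n) :
  complex.Im (pairing w y) = (map_mx (@complex.Im R) w^T *m y) 0 0.
Proof. by rewrite -map_Im_mulmx [RHS]mxE. Qed.

Lemma left_eigenvector_Re_Im (R : realType) n (A : 'M[R]_n) (lambda : R[i])
    (w : 'cV[R[i]]_n) :
  left_eigenvector A lambda w ->
  let a := complex.Re lambda in let b := complex.Im lambda in
  let u := map_mx (@complex.Re R) w^T in
  let v := map_mx (@complex.Im R) w^T in
  u *m A = a *: u - b *: v /\ v *m A = b *: u + a *: v.
Proof.
case=> _ wA /=; rewrite -map_Re_mulmx -map_Im_mulmx wA.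
split; apply/matrixP => i j; rewrite !mxE;
  case: lambda {wA} => a b; case: (w _ _) => c d //=.
by rewrite addrC.
Qed.

(** The modulus of w^T e^{tA} y = e^{lambda t} w^T y. *)
Lemma sqr_norm_pairing_expmx (R : realType) n (A : 'M[R]_n.+1) (lambda : R[i])
    (w : 'cV[R[i]]_n.+1) (y : 'cV[R]_n.+1) (t : R) :
  left_eigenvector A lambda w ->
  `|pairing w (expmx (t *: A) *m y)| ^+ 2 =
  (expR (2 * complex.Re lambda * t))%:C * `|pairing w y| ^+ 2.
Proof.
move=> /left_eigenvector_Re_Im/=.
set a := complex.Re _; set b := complex.Im _ => -[uA vA].
rewrite -!add_Re2_Im2 -rmorphM; congr _%:C.
rewrite !Re_pairing !Im_pairing !mulmxA.
set u := map_mx _ _ in uA vA *; set v := map_mx _ _ in uA vA *.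
have E0 (r : 'rV_n.+1) : (r *m y) 0 0 = (r *m expmx (0 *: A) *m y) 0 0.
  by rewrite scale0r expmx0 mulmx1.
rewrite (E0 u) (E0 v).
apply: (planar_ode_norm (b := b)
  (f := fun s => (u *m expmx (s *: A) *m y) 0 0)
  (g := fun s => (v *m expmx (s *: A) *m y) 0 0)) => s.
- have := is_derive_mxbilinear_expmx A u y s.
  by rewrite uA !mulmxBl -!scalemxAl !mxE.
- have := is_derive_mxbilinear_expmx A v y s.
  by rewrite vA !mulmxDl -!scalemxAl !mxE.
Qed.

(** A real left eigenvector of a real matrix belongs to a real eigenvalue, so
    w^T e^{tA} y obeys a scalar equation and its sign is controlled, not only
    its modulus. *)
Lemma real_pairing_expmx (R : realType) n (A : 'M[R]_n.+1) (lambda : R[i])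
    (w : 'cV[R[i]]_n.+1) (y : 'cV[R]_n.+1) (t : R) :
  left_eigenvector A lambda w -> (forall k, w k 0 \is Num.real) ->
  pairing w (expmx (t *: A) *m y) =
  (expR (complex.Re lambda * t))%:C * pairing w y.
Proof.
move=> /left_eigenvector_Re_Im/=.
set a := complex.Re _; set b := complex.Im _ => -[uA vA] wR.
have v0 : map_mx (@complex.Im R) w^T = 0.
  apply/matrixP => i j; rewrite !mxE (ord1 i).
  by case: (w j 0) (wR j) => c d; rewrite complex_real => /eqP.
have pR z : pairing w z = ((map_mx (@complex.Re R) w^T *m z) 0 0)%:C.
  rewrite -Re_pairing; apply/eqP; rewrite eq_complex /= eqxx Im_pairing v0.
  by rewrite mul0mx mxE eqxx.
rewrite !pR -rmorphM; congr _%:C; rewrite mulmxA.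
set u := map_mx _ _ in uA *.
have -> : (u *m y) 0 0 = (u *m expmx (0 *: A) *m y) 0 0.
  by rewrite scale0r expmx0 mulmx1.
apply: (linear_ode (f := fun s => (u *m expmx (s *: A) *m y) 0 0)) => s.
have := is_derive_mxbilinear_expmx A u y s.
by rewrite uA v0 scaler0 subr0 -!scalemxAl
  [in X in is_derive _ _ _ X -> _]mxE.
Qed.

(** * Invariance of the cone *)

Theorem theorem2 (R : realType) (n : nat) (A : 'M[R]_n.+1)
    (lambda : 'I_n.+1 -> R[i]) (w : 'I_n.+1 -> 'cV[R[i]]_n.+1)
    (A_diag : diagonalizable (complexmx A))
    (A_spectrum : char_poly (complexmx A)
                  = \prod_(i < n.+1) ('X - (lambda i)%:P))
    (lambda1_simple : mup (lambda ord0) (char_poly (complexmx A)) = 1%N)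
    (lambda1_real : lambda ord0 \is Num.real)
    (lambda1_neg : lambda ord0 < 0)
    (lambda1_dom : forall j, j != ord0 -> 'Re (lambda j) < lambda ord0)
    (w_eigen : forall i, left_eigenvector A (lambda i) (w i))
    (w_free : free [tuple w i | i < n.+1])
    (w1_real : forall k, w ord0 k ord0 \is Num.real)
    (alpha : 'I_n.+1 -> R)
    (alpha_gt0 : forall i, i != ord0 -> 0 < alpha i) :
  positive_system A (cone w alpha).
Proof.
move=> t t_ge0 _ [y Ky <-]; rewrite /cone/= in Ky *.
rewrite (real_pairing_expmx _ _ (w_eigen ord0) w1_real).
set e := expR _.
have e_ge0 : 0 <= e%:C by rewrite lecR expR_ge0.
have term_ge0 z i : i != ord0 -> 0 <= (alpha i)%:C * `|pairing (w i) z| ^+ 2.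
  by move=> i0; rewrite mulr_ge0 ?exprn_ge0// lecR ltW// alpha_gt0.
have sum_ge0 z :
    0 <= \sum_(i < n.+1 | i != ord0) (alpha i)%:C * `|pairing (w i) z| ^+ 2.
  by apply: sumr_ge0 => i; exact: term_ge0.
(* The left-hand side gains at most the factor e, the right-hand side exactly
   e; this factor is moved under the square root as e ^+ 2. *)
apply: le_trans (ler_wpM2l e_ge0 Ky).
rewrite -{1}(sqrCK e_ge0) -sqrtCM ?nnegrE ?exprn_ge0//.
rewrite ler_sqrtC ?nnegrE ?mulr_ge0 ?exprn_ge0//.
rewrite mulr_sumr; apply: ler_sum => i i0.
rewrite (sqr_norm_pairing_expmx _ _ (w_eigen i)) mulrCA.
rewrite ler_wpM2r ?term_ge0// -rmorphXn lecR expr2 -expRD ler_expR.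
rewrite -mulrDl ler_wpM2r// mulr2n mulrDl !mul1r.
have Re_le : complex.Re (lambda i) <= complex.Re (lambda ord0).
  by rewrite ltW// -ltcR complexRe (RRe_real lambda1_real) lambda1_dom.
exact: lerD.
Qed.
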